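(* Let $(x,y,\sigma)\in X\times[0,\infty)\times[0,1]$. There exist $z_1^b,\dots,z_N^b\in\mathbb{R}$ such that $(x,y,\sigma,z^b)$ satisfies the $N$-partition formulation (P1)--(P5) given in the context if and only if, with $\sigma':=1-\sigma$, $$y \le \sum_{i\in\mathcal{I}_j} w_i x_i+\sigma'\Big(b+\sum_{i\in\mathcal{I}\setminus\mathcal{I}_j}\mathit{UB}_i\Big)+(\sigma'-1)\sum_{i\in\mathcal{I}_j}\mathit{LB}_i\qquad\text{for all } j=1,\dots,2^N,$$ $$y\ge w^T x+b,\qquad y\le \sigma'\,\mathit{UB}^0 .$$ Here $\mathcal{I}=\{1,\dots,\eta\}$, and $\mathcal{I}_1,\dots,\mathcal{I}_{2^N}$ are the unions $\bigcup_{n\in A}\mathbb{S}_n$ as $A$ ranges over all $2^N$ subsets of $\{1,\dots,N\}$. In particular the same equivalence holds when $\sigma$ (equivalently $\sigma'$) is restricted to $\{0,1\}$.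
   Context: Setting: a ReLU node $y=\max(0,w^T x+b)$ with fixed weights $w\in\mathbb{R}^\eta$, $b\in\mathbb{R}$, and bounded inputs $x\in X=\prod_{i=1}^\eta[\underline{x}_i,\bar{x}_i]$ with $\underline{x}_i\le\bar{x}_i$. The reals $\mathit{LB}_i,\mathit{UB}_i$ are valid bounds of the weighted inputs: $\mathit{LB}_i\le w_i x_i\le \mathit{UB}_i$ for all $x\in X$. Set $\mathit{UB}^0=b+\sum_{i=1}^\eta \mathit{UB}_i$. The index set $\{1,\dots,\eta\}$ is partitioned into pairwise disjoint nonempty sets $\mathbb{S}_1,\dots,\mathbb{S}_N$. The bounds on partitions are $\mathit{LB}_n^a=\mathit{LB}_n^b=\sum_{i\in\mathbb{S}_n}\mathit{LB}_i$ and $\mathit{UB}_n^a=\mathit{UB}_n^b=\sum_{i\in\mathbb{S}_n}\mathit{UB}_i$. The $N$-partition formulation, in variables $x\in X$, $y\in[0,\infty)$, $\sigma$ (binary, or in $[0,1]$ in the continuous relaxation) and auxiliary variables $z^b=(z_1^b,\dots,z_N^b)\in\mathbb{R}^N$, is: (P1) $\sum_{n=1}^N\big(\sum_{i\in\mathbb{S}_n}w_i x_i-z_n^b\big)+\sigma b\le 0$; (P2) $\sum_{n=1}^N z_n^b+(1-\sigma)b\ge 0$; (P3) $y=\sum_{n=1}^N z_n^b+(1-\sigma)b$; (P4) $\sigma\,\mathit{LB}_n^a\le\sum_{i\in\mathbb{S}_n}w_i x_i-z_n^b\le\sigma\,\mathit{UB}_n^a$ for $n=1,\dots,N$; (P5)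 $(1-\sigma)\,\mathit{LB}_n^b\le z_n^b\le(1-\sigma)\,\mathit{UB}_n^b$ for $n=1,\dots,N$. *)

(* Defs.v *)
(* Mathematical Components, with the reals as an abstract realType. *)
From HB Require Import structures.
From mathcomp Require Import all_boot all_order all_algebra.
From mathcomp Require Import reals.

Set Implicit Arguments.
Unset Strict Implicit.
Unset Printing Implicit Defensive.

Import Order.TTheory GRing.Theory Num.Theory.

Local Open Scope ring_scope.

Section ReLUPartition.
Variables (R : realType) (eta N : nat).
Implicit Types (w x xlo xhi : 'cV[R]_eta) (z : 'cV[R]_N) (b y s : R).
Implicit Types (S : 'I_N -> {set 'I_eta}) (LB UB : 'I_eta -> R).

Definition in_box xlo xhi x : Prop :=
  forall i, xlo i 0 <= x i 0 <= xhi i 0.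

Definition valid_bounds xlo xhi w LB UB : Prop :=
  forall x, in_box xlo xhi x -> forall i, LB i <= w i 0 * x i 0 <= UB i.

Definition partitions_inputs S : Prop :=
  [/\ forall n, S n != set0,
      forall m n, m != n -> [disjoint S m & S n]
    & \bigcup_n S n = [set: 'I_eta]].

Definition block_sum S (F : 'I_eta -> R) (n : 'I_N) : R := \sum_(i in S n) F i.

Definition block_input S w x (n : 'I_N) : R :=
  block_sum S (fun i => w i 0 * x i 0) n.

(* The domains of x, y and s are not part of this predicate. [LBa], [UBa]
   bound the parts of the blocks active for s = 1, [LBb], [UBb] those active
   for s = 0. *)
Definition partition_formulation S w b (LBa UBa LBb UBb : 'I_N -> R)
    x y s z : Prop :=
  [/\ \sum_n (block_input S w x n - z n 0) + s * b <= 0,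
      \sum_n z n 0 + (1 - s) * b >= 0,
      y = \sum_n z n 0 + (1 - s) * b,
      forall n, s * LBa n <= block_input S w x n - z n 0 <= s * UBa n
    & forall n, (1 - s) * LBb n <= z n 0 <= (1 - s) * UBb n].

(* The index sets of the first family of inequalities are the unions of blocks
   over all subsets [A] of the set of blocks; [s'] stands for 1 - s. *)
Definition projected_formulation S w b LB UB x y s' : Prop :=
  [/\ forall A : {set 'I_N},
        let I_A := \bigcup_(n in A) S n in
        y <= \sum_(i in I_A) w i 0 * x i 0
             + s' * (b + \sum_(i in ~: I_A) UB i)
             + (s' - 1) * \sum_(i in I_A) LB i,
      y >= (w^T *m x) 0 0 + b
    & y <= s' * (b + \sum_i UB i)].

End ReLUPartition.

(* Main.v *)
Require Import Defs.
From HB Require Import structures.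
From mathcomp Require Import all_boot all_order all_algebra.
From mathcomp Require Import reals.
From mathcomp Require Import lra.

(** Everything happens at the level of blocks.  Write [p n] for the weighted
    input of block [n] and [L n <= p n <= U n] for its bounds.  For fixed
    [(x, y, s)] the two families of bounds on blocks confine each [z n] to the
    interval between [Num.max (p n - s * U n) ((1 - s) * L n)] and
    [Num.min (p n - s * L n) ((1 - s) * U n)], which is nonempty because
    [L n <= p n <= U n] and [0 <= s <= 1], while the equation for [y] prescribes
    the sum of the [z n] as [y - (1 - s) * b].  The sums of points of a product
    of intervals fill exactly the interval between the sum of the lower ends and
    the sum of the upper ends ([exists_sum_in_box]), so the elimination of [z]
    leaves two inequalities on that prescribed sum.

    A sum of minima is at most every sum in which one of the two terms is
    chosen for each index, and equals one of them; the choices are the sets of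
    blocks, and this turns the upper inequality into the projected family
    ([le_sum_minP]).  The lower inequality follows from [\sum_n p n + b <= y]
    and [0 <= y], to which the first two constraints reduce once [y] is
    substituted: this is why no second family of exponential size appears
    ([sum_lower_ends_le]).  The bound [y <= (1 - s) * (b + \sum_i UB i)] is the
    member of the projected family given by the empty set of blocks.  Since the
    blocks are disjoint and cover the inputs, sums over inputs are sums over
    blocks, which transports [block_projection] to the stated form. *)

Set Implicit Arguments.
Unset Strict Implicit.
Unset Printing Implicit Defensive.

Import Order.TTheory GRing.Theory Num.Theory.

Local Open Scope ring_scope.

(** * Sums of choices between two families *)

Section Choices.
Variables (I : finType) (R : realDomainType).
Implicit Types (f g : I -> R) (A : {set I}).

Lemma sum_setC f A :
  \sum_i f i = \sum_(i in A) f i + \sum_(i in ~: A) f i.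
Proof.
by rewrite (bigID (mem A)) /=; congr (_ + _); apply: eq_bigl => i; rewrite inE.
Qed.

Lemma sum_choice f g A :
  \sum_i (if i \in A then f i else g i)
    = \sum_(i in A) f i + \sum_(i in ~: A) g i.
Proof.
rewrite (sum_setC _ A); congr (_ + _); apply: eq_bigr => i.
  by move=> ->.
by rewrite inE => /negbTE ->.
Qed.

(** The tightest of the bounds on the right is the one for the set of indices
    where [f] is the smaller term. *)
Lemma le_sum_minP f g t :
  reflect (forall A, t <= \sum_(i in A) f i + \sum_(i in ~: A) g i)
          (t <= \sum_i Num.min (f i) (g i)).
Proof.
apply: (iffP idP) => [le_t A | /(_ [set i | f i < g i])].
  apply: le_trans le_t _; rewrite -sum_choice; apply: ler_sum => i _.
  by case: ifP; rewrite ge_min lexx ?orbT.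
rewrite -sum_choice => /le_trans; apply.
by apply: ler_sum => i _; rewrite inE minElt.
Qed.

Lemma sum_max_le f g t :
  (forall A, \sum_(i in A) f i + \sum_(i in ~: A) g i <= t) ->
  \sum_i Num.max (f i) (g i) <= t.
Proof.
move=> /(_ [set i | g i < f i]); rewrite -sum_choice; apply: le_trans.
by apply: ler_sum => i _; rewrite inE maxC maxElt.
Qed.

End Choices.

(** Moving from the lower corner to the upper corner at constant speed along the
    diagonal of the box, the sum of the coordinates passes through every
    intermediate value. *)
Lemma exists_sum_in_box (I : finType) (R : realFieldType) (lo hi : I -> R) t :
  (forall i, lo i <= hi i) -> \sum_i lo i <= t <= \sum_i hi i ->
  exists2 z : I -> R, forall i, lo i <= z i <= hi i & \sum_i z i = t.
Proof.
move=> lo_hi /andP[lo_t t_hi].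
pose d := \sum_i hi i - \sum_i lo i; pose c := (t - \sum_i lo i) / d.
have d_ge0 : 0 <= d by rewrite subr_ge0 (le_trans lo_t).
have c_ge0 : 0 <= c by rewrite (divr_ge0 _ d_ge0) // subr_ge0.
(* When the two corners coincide, c = 0 since dividing by 0 gives 0. *)
have c_le1 : c <= 1.
  rewrite /c; have [->|d_neq0] := eqVneq d 0; first by rewrite invr0 mulr0.
  by rewrite ler_pdivrMr ?lt_def ?d_neq0 // mul1r lerD2r.
have cd : c * d = t - \sum_i lo i.
  rewrite /c; have [d0|d_neq0] := eqVneq d 0; last by rewrite divfK.
  rewrite d0 mulr0; move: d0; rewrite /d; lra.
exists (fun i => lo i + c * (hi i - lo i)) => [i|].
  by have := lo_hi i; nra.
by rewrite big_split /= -mulr_sumr sumrB cd addrC subrK.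
Qed.

(** * Eliminating the auxiliary variables of the blocks *)

Section Blocks.
Variables (I : finType) (R : realFieldType) (L U p : I -> R) (b y s : R).
Hypotheses (p_ge : forall n, L n <= p n) (p_le : forall n, p n <= U n).
Hypotheses (s_ge0 : 0 <= s) (s_le1 : s <= 1).

(** With [t] and [T] the sums of [p] and of [U] over [A], both increased by [b]
    and by the sum of [L] over the other blocks, the claim reads
    [t - s * T <= y].  Since [t <= T], its left side is at most [(1 - s) * t],
    and both [t] and [0] are at most [y]. *)
Lemma sum_lower_ends_le (A : {set I}) : 0 <= y -> \sum_n p n + b <= y ->
  \sum_(n in A) (p n - s * U n) + \sum_(n in ~: A) (1 - s) * L n
    <= y - (1 - s) * b.
Proof.
move=> y_ge0; rewrite (sum_setC _ A) sumrB -!mulr_sumr => py.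
have pU : \sum_(n in A) p n <= \sum_(n in A) U n by apply: ler_sum.
have Lp : \sum_(n in ~: A) L n <= \sum_(n in ~: A) p n by apply: ler_sum.
move: (\sum_(n in A) p n) (\sum_(n in A) U n) pU py.
move: (\sum_(n in ~: A) L n) (\sum_(n in ~: A) p n) Lp.
move=> l q lq pA uA pu py; pose t := pA + l + b; pose T := uA + l + b.
have tT : s * t <= s * T by apply: ler_wpM2l => //; rewrite /t /T; lra.
have ty : (1 - s) * t <= (1 - s) * y.
  by apply: ler_wpM2l; [rewrite subr_ge0 | rewrite /t; lra].
have sy : 0 <= s * y by apply: mulr_ge0.
by move: tT ty; rewrite /t /T; lra.
Qed.

Lemma block_projection : 0 <= y ->
  (exists z : I -> R,
    [/\ y = \sum_n z n + (1 - s) * b, \sum_n p n + b <= y,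
        forall n, s * L n <= p n - z n <= s * U n
      & forall n, (1 - s) * L n <= z n <= (1 - s) * U n])
  <->
  (forall A : {set I},
     y - (1 - s) * b
       <= \sum_(n in A) (p n - s * L n) + \sum_(n in ~: A) (1 - s) * U n)
  /\ \sum_n p n + b <= y.
Proof.
move=> y_ge0; split=> [[z [yE py za zb]] | [/le_sum_minP y_min py]].
  split=> //; apply/le_sum_minP; rewrite yE addrK; apply: ler_sum => n _.
  by rewrite le_min; have := za n; have := zb n; lra.
pose lo n := Num.max (p n - s * U n) ((1 - s) * L n).
pose hi n := Num.min (p n - s * L n) ((1 - s) * U n).
have lo_hi n : lo n <= hi n.
  have pU := p_le n; have Lp := p_ge n; have LU := le_trans Lp pU.
  have sLU : s * L n <= s * U n by apply: ler_wpM2l.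
  have s'LU : (1 - s) * L n <= (1 - s) * U n by rewrite ler_wpM2l ?subr_ge0.
  by rewrite ge_max !le_min; apply/andP; split; apply/andP; split; lra.
have [|z z_in zE] := @exists_sum_in_box _ _ lo hi (y - (1 - s) * b) lo_hi.
  rewrite y_min andbT; apply: sum_max_le => A; exact: sum_lower_ends_le.
exists z; split=> //; first by rewrite zE subrK.
  by move=> n; have := z_in n; rewrite ge_max le_min; lra.
by move=> n; have := z_in n; rewrite ge_max le_min; lra.
Qed.

End Blocks.

(** * From inputs to blocks *)

Section Partition.
Variables (R : realType) (eta N : nat) (S : 'I_N -> {set 'I_eta}).
Hypothesis hS : partitions_inputs S.

Lemma sum_bigcup_blocks (F : 'I_eta -> R) (A : {set 'I_N}) :
  \sum_(i in \bigcup_(n in A) S n) F i = \sum_(n in A) block_sum S F n.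
Proof.
have [_ disjS _] := hS.
rewrite [\bigcup_(n in A) _]big_mkcond.
rewrite partition_disjoint_bigcup /= => [|m n mn].
  by rewrite [RHS]big_mkcond; apply: eq_bigr => n _; case: ifP; rewrite ?big_set0.
have disj0 (B : {set 'I_eta}) : [disjoint set0 & B].
  by rewrite -setI_eq0 set0I.
by do 2![case: ifP => _]; rewrite ?disjS ?disj0 // disjoint_sym disj0.
Qed.

Lemma sum_blocks (F : 'I_eta -> R) : \sum_i F i = \sum_n block_sum S F n.
Proof.
have [_ disjS covS] := hS.
rewrite -partition_disjoint_bigcup // covS.
by apply: eq_bigl => i; rewrite inE.
Qed.

Lemma sum_setC_bigcup_blocks (F : 'I_eta -> R) (A : {set 'I_N}) :
  \sum_(i in ~: \bigcup_(n in A) S n) F i = \sum_(n in ~: A) block_sum S F n.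
Proof.
apply: (addrI (\sum_(i in \bigcup_(n in A) S n) F i)).
by rewrite -sum_setC sum_bigcup_blocks -sum_setC sum_blocks.
Qed.

Lemma partition_formulation_projection (w : 'cV[R]_eta) b (LB UB : 'I_eta -> R)
    (x : 'cV[R]_eta) (y s : R) :
  (forall i, LB i <= w i 0 * x i 0 <= UB i) -> 0 <= y -> 0 <= s <= 1 ->
  (exists z : 'cV[R]_N,
     partition_formulation S w b (block_sum S LB) (block_sum S UB)
       (block_sum S LB) (block_sum S UB) x y s z)
  <-> projected_formulation S w b LB UB x y (1 - s).
Proof.
move=> wx y_ge0 /andP[s_ge0 s_le1]; pose p := block_input S w x.
have p_ge n : block_sum S LB n <= p n.
  by apply: ler_sum => i _; case/andP: (wx i).
have p_le n : p n <= block_sum S UB n.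
  by apply: ler_sum => i _; case/andP: (wx i).
have wxE : (w^T *m x) 0 0 = \sum_n p n.
  by rewrite mxE -sum_blocks; apply: eq_bigr => i _; rewrite mxE.
have := block_projection b p_ge p_le s_ge0 s_le1 y_ge0.
case=> elim_z intro_z; split=> [[z [P1 P2 P3 P4 P5]] | [fam y_wx _]].
  have {elim_z} [|fam py] := elim_z.
    exists (fun n => z n 0); split=> //.
    by move: P1; rewrite -/p sumrB P3; lra.
  split; last 1 first.
  (* The empty set of blocks selects the upper bound of every block. *)
  - have := fam set0.
    rewrite sum_blocks (sum_setC _ set0) !big_set0 -mulr_sumr.
    by lra.
  - move=> A /=; have := fam A.
    rewrite sum_setC_bigcup_blocks !sum_bigcup_blocks sumrB -!mulr_sumr.
    by rewrite -/p; lra.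
  - by rewrite wxE.
have {intro_z} [|z [yE py za zb]] := intro_z.
  split=> [A|]; last by rewrite -wxE.
  have := fam A; rewrite /= sum_setC_bigcup_blocks !sum_bigcup_blocks.
  by rewrite sumrB -!mulr_sumr -/p; lra.
have zE n : (\col_m z m) n 0 = z n by rewrite mxE.
exists (\col_n z n); split.
- under eq_bigr do rewrite zE.
  by rewrite sumrB -/p; lra.
- by under eq_bigr do rewrite zE; rewrite -yE.
- by under eq_bigr do rewrite zE.
- by move=> n; rewrite zE.
- by move=> n; rewrite zE.
Qed.

End Partition.

Theorem proposition1 (R : realType) (eta N : nat)
    (w : 'cV[R]_eta) (b : R) (xlo xhi : 'cV[R]_eta)
    (LB UB : 'I_eta -> R) (S : 'I_N -> {set 'I_eta})
    (hbox : forall i, xlo i 0 <= xhi i 0)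
    (hbounds : valid_bounds xlo xhi w LB UB)
    (hS : partitions_inputs S) :
  (forall (x : 'cV[R]_eta) (y sigma : R),
     in_box xlo xhi x -> 0 <= y -> 0 <= sigma <= 1 ->
     ((exists z : 'cV[R]_N,
         partition_formulation S w b (block_sum S LB) (block_sum S UB)
           (block_sum S LB) (block_sum S UB) x y sigma z)
      <-> projected_formulation S w b LB UB x y (1 - sigma)))
  /\
  (forall (x : 'cV[R]_eta) (y sigma : R),
     in_box xlo xhi x -> 0 <= y -> sigma = 0 \/ sigma = 1 ->
     ((exists z : 'cV[R]_N,
         partition_formulation S w b (block_sum S LB) (block_sum S UB)
           (block_sum S LB) (block_sum S UB) x y sigma z)
      <-> projected_formulation S w b LB UB x y (1 - sigma))).
Proof.
split=> x y sigma x_box y_ge0 hsigma.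
  exact: (partition_formulation_projection hS b (hbounds x x_box) y_ge0 hsigma).
apply: (partition_formulation_projection hS b (hbounds x x_box) y_ge0).
by case: hsigma => ->; rewrite lexx ler01.
Qed.
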